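(* If $G$ is an even Hamiltonian graph and $n\ge 4$, then the exponential graph $G^{K_n}$ has two completely independent spanning trees.
   Context: A graph means a finite simple undirected graph with at least one vertex. A graph is even if it has an even number of vertices. A cycle has length at least 3; a Hamiltonian cycle is a cycle containing every vertex, and a graph is Hamiltonian if it has a Hamiltonian cycle. $K_n$ is the complete graph on $n$ vertices. Completely independent spanning trees in a graph $G$ are spanning trees of $G$ such that for any two distinct vertices $u,v$ of $G$, the paths between $u$ and $v$ in the spanning trees mutually have no common edge and no common vertex except for $u$ and $v$. Exponential graph: for graphs $G$ and $H$ with $V(H)=\{w_1,\ldots,w_q\}$, the exponential graph $G^H$ has vertex set $\{(u_1,\ldots,u_q;w_j) : u_i\in V(G)\ (1\le i\le q),\ 1\le j\le q\}$, and two vertices $(u_1,\ldots,u_q;w_j)$ and $(v_1,\ldots,v_q;w_k)$ are adjacent if and only if either ($j=k$, $u_jv_j\in E(G)$, and $u_i=v_i$ for all $i\ne j$) or ($j\neq k$, $w_jw_k\in E(H)$, and $u_i=v_i$ for all $i$). *)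

(* Defs.v *)
From mathcomp Require Import all_boot.

Set Implicit Arguments.
Unset Strict Implicit.
Unset Printing Implicit Defensive.

(* Graphs are indexed by their vertex type, so that a spanning subgraph of
   [G : sgraph V] is simply another [T : sgraph V].  The vertex set may be
   empty; Hamiltonian graphs never are. *)
Record sgraph (V : finType) := SGraph {
  adj : rel V;
  adj_sym : symmetric adj;
  adj_irr : irreflexive adj
}.

Section Graphs.
Variable V : finType.
Implicit Types (G T : sgraph V) (u v w : V) (p q c : seq V).

(* The closing edge from the last vertex of [c] back to the first one is part
   of [cycle]; [c] lists each vertex once. *)
Definition is_cycle G c := [&& 3 <= size c, cycle (adj G) c & uniq c].

Definition hamiltonian G := exists2 c, is_cycle G c & forall v, v \in c.

Definition connected G := forall u v, connect (adj G) u v.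

Definition acyclic G := forall c, ~~ is_cycle G c.

Definition tree G := connected G /\ acyclic G.

Definition spanning_tree G T := subrel (adj T) (adj G) /\ tree T.

(* The vertices of the path are those of [u :: p]. *)
Definition is_path G u v p :=
  [&& path (adj G) u p, last u p == v & uniq (u :: p)].

Definition path_edges u p : seq {set V} := pairmap (fun x y => [set x; y]) u p.

(* In a tree the path between two vertices exists and is unique, so
   quantifying over all [p] and [q] speaks about the paths between [u] and [v]
   in the two trees.  As soon as there are two vertices, the edge condition
   forces the members of the family to be pairwise distinct. *)
Definition completely_independent_spanning_trees
    G (k : nat) (T : 'I_k -> sgraph V) :=
  (forall i, spanning_tree G (T i)) /\
  (forall i j, i != j -> forall u v, u != v ->
   forall p q, is_path (T i) u v p -> is_path (T j) u v q ->
     (forall e, e \in path_edges u p -> e \notin path_edges u q) /\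
     (forall w, w \in u :: p -> w \in u :: q -> w = u \/ w = v)).

End Graphs.

Section Complete.
Variable n : nat.

Definition complete_adj : rel 'I_n := fun i j => i != j.

Lemma complete_adj_sym : symmetric complete_adj.
Proof. by move=> i j; rewrite /complete_adj eq_sym. Qed.

Lemma complete_adj_irr : irreflexive complete_adj.
Proof. by move=> i; rewrite /complete_adj eqxx. Qed.

Definition complete_graph : sgraph 'I_n :=
  SGraph complete_adj_sym complete_adj_irr.

End Complete.

Section Exponential.
Variables (V W : finType) (G : sgraph V) (H : sgraph W).

(* Coordinates are indexed by the vertices of [H] themselves: (u_1,...,u_q; w_j)
   is the pair of the function w_i |-> u_i and the vertex w_j. *)
Definition exp_vertex : finType := ({ffun W -> V} * W)%type.

Definition exp_adj : rel exp_vertex := fun x y =>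
  [&& x.2 == y.2, adj G (x.1 x.2) (y.1 x.2)
    & [forall i, (i != x.2) ==> (x.1 i == y.1 i)]]
  || [&& x.2 != y.2, adj H x.2 y.2 & [forall i, x.1 i == y.1 i]].

Lemma exp_adj_sym : symmetric exp_adj.
Proof.
move=> [u j] [v k]; rewrite /exp_adj /= (eq_sym k) (adj_sym H k).
congr (_ || _); last first.
  by congr [&& _, _ & _]; apply: eq_forallb => i; rewrite eq_sym.
case: eqVneq => //= <-; rewrite adj_sym; congr (_ && _).
by apply: eq_forallb => i; rewrite (eq_sym (u i)).
Qed.

Lemma exp_adj_irr : irreflexive exp_adj.
Proof. by move=> x; rewrite /exp_adj adj_irr eqxx. Qed.

Definition exp_graph : sgraph exp_vertex := SGraph exp_adj_sym exp_adj_irr.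

End Exponential.

(* Main.v *)
(**
Two completely independent spanning trees come from a 2-colouring of the
vertices in which each colour class induces a connected subgraph, together
with a map [phi] sending every vertex to a neighbour of the other colour and
having no 2-cycle: a spanning tree of each class is completed by hanging every
vertex [v] of the other class as a leaf at [phi v].  The inner vertices of the
paths of the two trees then have different colours, and the only edges that the
trees could share would be 2-cycles of [phi].

In the exponential graph, label the vertices of the base graph by pairs of bits
[(a, e)], all four pairs being used, and put
[g p q = a p + a q + e p * e q] over the field with two elements.  The first
four coordinates form two blocks (0,1) and (2,3).  The colour of [(u; j)] for
[j] in a block is [g] of the coordinates of the other block, negated for the
second position of the block.  So every clique over [u] contains two vertices
of each colour among its first four, hence a bichromatic 4-cycle, along which
[phi] runs.  The colour of [(u; j)] does not depend on [u_j], so that inside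
one class the coordinate [j] may be changed freely whenever [(u; j)] belongs to
the class.  Connectedness of the classes follows because rows of [g] with
different [e] take any prescribed pair of values in some common column.  Such a
labelling exists because an even Hamiltonian graph has at least four vertices.
*)
Require Import Defs.
From mathcomp Require Import all_boot.

Set Implicit Arguments.
Unset Strict Implicit.
Unset Printing Implicit Defensive.

(** * Spanning trees from reachability *)

Section SpanningTree.
Variable V : finType.
Implicit Types (e : rel V) (r v x y : V).

(** With [d] the distance from [r], the parent is the last but one vertex of a shortest walk. The
    relation [e] may be directed. *)
Lemma bfs_parent e r : (forall v, connect e r v) ->
  exists (par : V -> V) (d : V -> nat),
    forall v, v != r -> e (par v) v && (d (par v) < d v).
Proof.
move=> er; pose reach v m := [exists p : m.-tuple V, path e r p && (last r p == v)].
have exr v : exists m, reach v m.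
  have /connectP[p ep vE] := er v.
  by exists (size p); apply/existsP; exists (in_tuple p); rewrite ep vE /=.
pose d v := ex_minn (exr v).
have ex v : v != r -> exists x, e x v && (d x < d v).
  move=> vr; rewrite {2}/d; case: ex_minnP => m /existsP[p /andP[ep /eqP pv]] _.
  case: p ep pv => p /=; case/lastP: p => [_ _ /= rv|q w]; first by rewrite -rv eqxx in vr.
  rewrite size_rcons last_rcons rcons_path => /eqP sq /andP[eq ew] wv.
  exists (last r q); rewrite -wv ew /= /d -sq; case: ex_minnP => k _; apply.
  by apply/existsP; exists (in_tuple q); rewrite eq /=.
(* The default [v] can occur only at the root. *)
exists (fun v => odflt v [pick x | e x v && (d x < d v)]), d => v /ex[x xP].
by case: pickP => //= /(_ x); rewrite xP.
Qed.

Lemma rooted_tree (par : V -> V) (d : V -> nat) r :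
  (forall v, v != r -> d (par v) < d v) ->
  exists2 T : sgraph V, tree T &
    forall x y, adj T x y = (x != r) && (par x == y) || (y != r) && (par y == x).
Proof.
move=> dpar; pose link x y := (x != r) && (par x == y).
have link_sym : symmetric (fun x y => link x y || link y x) by move=> x y; rewrite orbC.
have link_irr : irreflexive (fun x y => link x y || link y x).
  move=> x; rewrite orbb; apply/negP => /andP[/dpar + /eqP xE].
  by rewrite xE ltnn.
exists (SGraph link_sym link_irr) => //; split=> [u v|c].
  have toroot x : connect (fun x y => link x y || link y x) x r.
    have [m] := ubnP (d x); elim: m => // m IHm in x *; rewrite ltnS => dx.
    have [->|xr] := eqVneq x r; first exact: connect0.
    apply: connect_trans (IHm (par x) (leq_trans (dpar _ xr) dx)).
    by apply: connect1; rewrite /link xr eqxx.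
  apply: connect_trans (toroot u) _.
  by rewrite (sym_connect_sym link_sym).
apply/negP => /and3P[c3 cyc uc].
have [w0 w0c] : exists w, w \in c by case: c c3 {cyc uc} => // w c _; exists w; apply: mem_head.
have [w wc wmax] := arg_maxnP d w0c.
(* All neighbours of a deepest vertex of the cycle are its parent. *)
have parw x : x \in c -> link w x || link x w -> x = par w.
  move=> xc /orP[/andP[_ /eqP->]//|/andP[/dpar + /eqP xw]].
  by rewrite xw ltnNge; have := wmax _ xc => /= ->.
have [i p pE] := rot_to wc.
have memc x : (x \in c) = (x \in w :: p) by rewrite -pE mem_rot.
move: cyc uc c3; rewrite -(rot_cycle i) -(rot_uniq i) -(size_rot i c) pE.
case: p memc {pE} => [|x [|y p]] // memc.
rewrite [cycle _ _]/= rcons_path /= => /andP[wx /andP[xy /andP[_ zw]]].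
have xpar : x = par w by apply: parw; rewrite ?memc ?inE ?eqxx ?orbT.
have ypar : last y p = par w.
  by apply: parw; [rewrite memc !inE -in_cons mem_last !orbT | rewrite orbC].
by move=> /and3P[_ /negP xp _]; case: xp; rewrite xpar -ypar mem_last.
Qed.

Lemma spanning_tree_of_rel e r : (forall v, connect e r v) ->
  exists2 T : sgraph V, tree T & forall x y, adj T x y -> e x y || e y x.
Proof.
move=> /bfs_parent[par [d parP]].
have [|T treeT adjT] := @rooted_tree par d r; first by move=> v /parP/andP[].
exists T => // x y; rewrite adjT => /orP[] /andP[/parP/andP[+ _] /eqP <-] => ->; rewrite ?orbT //.
Qed.
End SpanningTree.

Lemma negb_neq (x y : bool) : x != y -> ~~ x = y.
Proof. by case: x; case: y. Qed.

(** * Independent trees from a two-colouring *)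

Section TwoColouring.
Variables (V : finType) (G : sgraph V) (col : V -> bool) (phi : V -> V).
Implicit Types (x y u v w : V).

Definition mono : rel V := fun x y => adj G x y && (col x == col y).

Hypothesis phi_adj : forall v, adj G v (phi v).
Hypothesis col_phi : forall v, col (phi v) = ~~ col v.
Hypothesis phi2 : forall v, phi (phi v) != v.
Hypothesis mono_connected : forall x y, col x = col y -> connect mono x y.

(** Arcs point away from the root. The only arc into a vertex outside class [b] comes from its image
    under [phi], which makes that vertex a leaf. *)
Definition pendant b : rel V :=
  fun x y => adj G x y && (if col y == b then col x == b else x == phi y).

Lemma pendant_connect b r v : col r = b -> connect (pendant b) r v.
Proof.
move=> rb.
have in_class y : col y = b -> connect (pendant b) r y.
  move=> yb; have /mono_connected/connectP[p] : col r = col y by rewrite rb.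
  move: yb => _.
  elim/last_ind: p y => [|p z IHp] y /=; first by move=> _ ->; apply: connect0.
  rewrite rcons_path last_rcons => /andP[rp /andP[pz /eqP cz]] ->.
  apply: connect_trans (IHp _ rp erefl) (connect1 _).
  have colp : col (last r p) = b.
    elim: p r rb rp {IHp pz cz} => //= t p IHp r0 r0b /andP[/andP[_ /eqP ct] tp].
    by apply: IHp; rewrite -?ct.
  by rewrite /pendant pz -cz colp eqxx.
have [/in_class//|vb] := eqVneq (col v) b.
apply: connect_trans (in_class (phi v) _) (connect1 _).
  by rewrite col_phi; apply: negb_neq.
by rewrite /pendant adj_sym phi_adj (negPf vb) /=.
Qed.

Definition tree_of_colour b (T : sgraph V) :=
  forall x y, adj T x y -> pendant b x y || pendant b y x.

(** An arc from [w] to [x] would force [w] to have colour [b], either directly or because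
    [w = phi x]. *)
Lemma tree_of_colour_leaf b T x w :
  tree_of_colour b T -> col w != b -> adj T x w -> x = phi w.
Proof.
move=> Tb wb /Tb /orP[]/andP[_]; first by rewrite (negPf wb) => /eqP.
case: eqP => xb; first by rewrite (negPf wb).
move=> /eqP wE; case/eqP: wb; rewrite wE col_phi.
exact/negb_neq/eqP.
Qed.

(** An inner vertex [w] of the wrong colour would have both its path neighbours equal to [phi w],
    but a path repeats no vertex. *)
Lemma inner_colour b T u v p w : tree_of_colour b T -> is_path T u v p ->
  w \in u :: p -> w != u -> w != v -> col w = b.
Proof.
move=> Tb /and3P[Tp /eqP pv up]; rewrite inE => /predU1P[->|wp]; first by rewrite eqxx.
case/splitPr: wp Tp pv up => p1 p2.
rewrite cat_path last_cat -cat_cons cat_uniq => /and3P[_ xw wy] wv + _ wNv.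
case: p2 wy wv => [|y p2] /= => [_ wv|/andP[wy _] _]; first by rewrite wv eqxx in wNv.
apply: contraTeq => wb.
have yE : y = phi w by apply: (tree_of_colour_leaf Tb wb); rewrite adj_sym.
have lastE : last u p1 = y by rewrite yE (tree_of_colour_leaf Tb wb xw).
by rewrite !negb_and /= -lastE mem_last orbT /= orbT.
Qed.

(** Each end of a common edge would be a leaf of one of the trees, hence each would be [phi] of the
    other, against [phi2]. *)
Lemma tree_of_colour_edge b T T' x y :
  tree_of_colour b T -> tree_of_colour (~~ b) T' -> adj T x y -> ~~ adj T' x y.
Proof.
move=> Tb Tb' xy; apply/negP => xy'.
have phiE z t : adj T z t -> adj T' z t -> col z = b -> t = phi z /\ col t = ~~ b.
  move=> zt zt' zb; have tE : t = phi z.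
    by apply: (tree_of_colour_leaf Tb'); rewrite 1?adj_sym ?zb //; case: (b).
  by rewrite tE col_phi zb.
have no z t : adj T z t -> adj T' z t -> col z = b -> False.
  move=> zt zt' zb; have [tE tb] := phiE z t zt zt' zb.
  have zE : z = phi t by apply: (tree_of_colour_leaf Tb) zt; rewrite tb; case: (b).
  by have /eqP := phi2 z; rewrite -tE -zE.
have [xb|xb] := eqVneq (col x) b; first exact: no xy xy' xb.
have yE := tree_of_colour_leaf Tb xb; rewrite adj_sym in xy; have {}yE := yE _ xy.
by apply: (no y x) => //; [rewrite adj_sym | rewrite yE col_phi; apply: negb_neq].
Qed.

Lemma path_edge_adj (T : sgraph V) u p e : path (adj T) u p ->
  e \in path_edges u p -> exists x y, e = [set x; y] /\ adj T x y.
Proof.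
elim: p u => //= z p IHp u /andP[uz zp]; rewrite inE => /predU1P[->|]; last exact: IHp.
by exists u, z.
Qed.

Lemma cist_of_colouring (x0 : V) :
  exists T : 'I_2 -> sgraph V, completely_independent_spanning_trees G T.
Proof.
have treeb b : exists T, tree_of_colour b T /\ tree T.
  have [r rb] : exists r, col r = b.
    have [<-|xb] := eqVneq (col x0) b; first by exists x0.
    by exists (phi x0); rewrite col_phi; apply: negb_neq.
  have [T treeT Tb] := spanning_tree_of_rel (fun v => pendant_connect v rb).
  by exists T.
have [[Tt [Ttb treeTt]] [Tf [Tfb treeTf]]] := (treeb true, treeb false).
pose T (i : 'I_2) := if val i == 0 then Tt else Tf.
have TP i : tree_of_colour (val i == 0) (T i) /\ tree (T i).
  by rewrite /T; case: eqP.
exists T; split=> [i|i j ij u v uv p q Tp Tq].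
  have [Tib treeTi] := TP i; split=> // x y /Tib /orP[]/andP[//].
  by rewrite adj_sym.
have [[Tib _] [Tjb _]] := (TP i, TP j).
have jE : (val j == 0) = ~~ (val i == 0).
  by case: i j ij {Tp Tq Tib Tjb} => -[|[|i]] // ? [[|[|j]]].
rewrite jE in Tjb; split=> [e ep|w wp wq].
  apply/negP => eq; case/and3P: Tp Tq => Tp _ _ /and3P[Tq _ _].
  have [x [y [eE xy]]] := path_edge_adj Tp ep.
  have [x' [y' [eE' xy']]] := path_edge_adj Tq eq.
  have /negP := tree_of_colour_edge Tib Tjb xy; apply.
  have xNy : x != y by apply: contraTneq xy => ->; rewrite adj_irr.
  have: x \in e by rewrite eE !inE eqxx.
  have: y \in e by rewrite eE !inE eqxx orbT.
  rewrite eE' !inE => /orP[]/eqP yE /orP[]/eqP xE; move: xNy xy'; rewrite xE yE ?eqxx //.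
  by rewrite adj_sym.
have [->|wu] := eqVneq w u; first by left.
have [->|wv] := eqVneq w v; first by right.
have := inner_colour Tib Tp wp wu wv; rewrite (inner_colour Tjb Tq wq wu wv).
by case: (val i == 0).
Qed.
End TwoColouring.

(** * The colouring of the exponential graph *)

Section ExponentialOfComplete.
Variables (V : finType) (G : sgraph V) (m : nat).
Variables (a e : V -> bool) (rep : bool -> bool -> V).
Hypothesis a_rep : forall x y, a (rep x y) = x.
Hypothesis e_rep : forall x y, e (rep x y) = y.
Hypothesis G_connected : connected G.

Notation J := 'I_m.+4.
Implicit Types (p q v w : V) (u : {ffun J -> V}) (j k : J) (s t b : bool).

Definition g p q := a p (+) a q (+) (e p && e q).

Lemma gC p q : g p q = g q p.
Proof. by rewrite /g (addbC (a p)) andbC. Qed.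

Definition pos s t : J := inord (s.*2 + t).

Lemma val_pos s t : pos s t = s.*2 + t :> nat.
Proof. by rewrite inordK //; case: s; case: t. Qed.

Lemma eq_pos s t s' t' : (pos s t == pos s' t') = (s == s') && (t == t').
Proof. by rewrite -val_eqE /= !val_pos; case: s; case: t; case: s'; case: t'. Qed.

Lemma pos_lt2 s t : (pos s t < 2) = ~~ s.
Proof. by rewrite val_pos; case: s; case: t. Qed.

Lemma pos_surj j : j < 4 -> exists s t, j = pos s t.
Proof.
move=> j4; exists (2 <= j), (odd j); apply/val_inj; rewrite /= val_pos.
by case: (val j) j4 => [|[|[|[|]]]].
Qed.

Definition block s u := g (u (pos s false)) (u (pos s true)).

(** For [j < 4], [block (j < 2)] is the block without [j]. For the other [j], the colour is read
    from coordinate 0, which differs from [j] and can set it at will. *)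
Definition colour u j :=
  if j < 4 then odd j (+) block (j < 2) u else a (u (pos false false)).

Lemma colour_pos u s t : colour u (pos s t) = t (+) block (~~ s) u.
Proof. by rewrite /colour pos_lt2 val_pos; case: s; case: t. Qed.

Definition upd u j v : {ffun J -> V} := [ffun i => if i == j then v else u i].

Lemma upd_idem u j v w : upd (upd u j w) j v = upd u j v.
Proof. by apply/ffunP => i; rewrite !ffunE; case: eqP. Qed.

Lemma block_upd u s t v : block s (upd u (pos s t) v) = g v (u (pos s (~~ t))).
Proof. by rewrite /block !ffunE !eq_pos eqxx; case: t => //=; rewrite gC. Qed.

Lemma block_updN u s t v : block (~~ s) (upd u (pos s t) v) = block (~~ s) u.
Proof. by rewrite /block !ffunE !eq_pos; case: s. Qed.

Lemma block_pos u s t : block s u = g (u (pos s t)) (u (pos s (~~ t))).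
Proof. by case: t => //; rewrite gC. Qed.

Lemma colour_upd u j v : colour (upd u j v) j = colour u j.
Proof.
have [/pos_surj[s [t ->]]|j4] := ltnP j 4; first by rewrite !colour_pos block_updN.
rewrite /colour ltnNge j4 /= ffunE; case: eqP j4 => // <-.
by rewrite val_pos.
Qed.

(** * Changing coordinates within one colour class *)

Section Moves.
Variables (b : bool) (Q : rel {ffun J -> V}).
Hypothesis Q_refl : reflexive Q.
Hypothesis Q_trans : transitive Q.
Hypothesis Q_step : forall u j v, colour u j = b -> Q u (upd u j v).

Lemma detour u j k v w : j != k -> Q u (upd u k w) ->
  Q (upd u k w) (upd (upd u k w) j v) ->
  Q (upd (upd u k w) j v) (upd (upd (upd u k w) j v) k (u k)) -> Q u (upd u j v).
Proof.
move=> jk Q1 Q2 Q3; suff <- : upd (upd (upd u k w) j v) k (u k) = upd u j v.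
  exact: Q_trans (Q_trans Q1 Q2) Q3.
apply/ffunP => i; rewrite !ffunE; case: (eqVneq i k) => [->|//].
by rewrite eq_sym (negPf jk).
Qed.

(** If the position has the wrong colour, some [k] in the other block has colour [b]. Changing [k]
    flips the value of that block and so corrects the position; since block [s] keeps its value, [k]
    can be restored afterwards. *)
Lemma move_keeping_block u s t v :
  block s (upd u (pos s t) v) = block s u -> Q u (upd u (pos s t) v).
Proof.
move=> keep; have [/Q_step//|jb] := eqVneq (colour u (pos s t)) b.
pose t' := b (+) block s u; pose k := pos (~~ s) t'.
(* Second bit [false] kills the product term of [g], so the first bit alone flips the block. *)
pose w := rep (~~ block (~~ s) u (+) a (u (pos (~~ s) (~~ t')))) false.
have kb : colour u k = b by rewrite colour_pos negbK addbK.
have kbw : block s (upd u k w) = block s u.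
  by rewrite -{1}[s]negbK /k block_updN negbK.
apply: (@detour _ _ k _ w); first by rewrite eq_pos; case: (s).
- exact: Q_step.
- apply: Q_step; rewrite colour_pos block_upd /g a_rep e_rep addbF addbK addbN.
  by rewrite -colour_pos; apply: negb_neq.
apply: Q_step; rewrite colour_pos negbK -/k block_upd ffunE eq_pos.
have -> : (s == ~~ s) = false by case: (s).
by rewrite /= -block_upd keep addbK.
Qed.

(** The two positions of a block have opposite colours, so [k] is free when the given one is not. It
    is moved to a column [w] where rows [p] and [v] agree, with the value needed to return to [q]
    after the change. *)
Lemma move_to_other_e u s t v : e v != e (u (pos s t)) -> Q u (upd u (pos s t) v).
Proof.
move=> ev; have [/Q_step//|jb] := eqVneq (colour u (pos s t)) b.
pose k := pos s (~~ t); pose p := u (pos s t); pose q := u k.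
have [keep|flip] := eqVneq (g v q) (g p q).
  by apply: move_keeping_block; rewrite block_upd (block_pos _ _ t).
pose y := a p (+) a v; pose w := rep (g v q (+) a p (+) (e p && y)) y.
(* [g p w + g v w = a p + a v + e w] since [e p + e v = 1]. *)
have gpw : g p w = g v q.
  rewrite {1}/g /w a_rep e_rep.
  by case: (g v q); case: (a p); case: (e p && y).
have gvw : g v w = g v q.
  move: ev; rewrite -/p {1}/g /w a_rep e_rep /y.
  move: flip; rewrite /g.
  by case: (a p); case: (a v); case: (e p); case: (e v); case: (a q); case: (e q).
have kb : colour u k = b.
  by move: jb; rewrite !colour_pos addNb; apply: negb_neq.
have jk : pos s t != k by rewrite eq_pos; case: (s); case: (t).
apply: (@detour _ _ k _ w) => //; first exact: Q_step.
  apply: move_keeping_block; rewrite block_upd /k block_upd negbK ffunE eqxx.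
  by rewrite gvw (gC w) gpw.
apply: move_keeping_block; rewrite block_upd negbK ffunE eqxx block_upd ffunE eqxx.
by rewrite gC gvw.
Qed.

Lemma move_pos u s t v : Q u (upd u (pos s t) v).
Proof.
have [ev|/move_to_other_e//] := eqVneq (e v) (e (u (pos s t))).
pose w := rep false (~~ e v).
apply: (@Q_trans (upd u (pos s t) w)).
  by apply: move_to_other_e; rewrite e_rep -ev; case: (e v).
rewrite -(upd_idem u (pos s t) v w).
by apply: move_to_other_e; rewrite ffunE eqxx e_rep; case: (e v).
Qed.

Lemma move_any u j v : Q u (upd u j v).
Proof.
have [/pos_surj[s [t ->]]|j4] := ltnP j 4; first exact: move_pos.
have jk : j != pos false false by apply: contraTneq j4 => ->; rewrite val_pos.
apply: (detour (w := rep b false) jk); try exact: move_pos.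
by apply: Q_step; rewrite /colour ltnNge j4 ffunE eqxx a_rep.
Qed.

Lemma move_everywhere u u' : Q u u'.
Proof.
have Qr (r : seq J) : Q u [ffun i => if i \in r then u' i else u i].
  elim: r => [|j r IHr].
    by rewrite (_ : [ffun _ => _] = u) //; apply/ffunP => i; rewrite ffunE.
  apply: Q_trans IHr _.
  rewrite (_ : [ffun i => if i \in j :: r then _ else _] =
    upd [ffun i => if i \in r then u' i else u i] j (u' j)); first exact: move_any.
  by apply/ffunP => i; rewrite !ffunE inE; case: eqP => // ->.
have := Qr (enum J); congr (Q u _).
by apply/ffunP => i; rewrite ffunE mem_enum.
Qed.
End Moves.

(** * Connected colour classes and the map to the other colour *)

Definition exp_colour (x : exp_vertex V J) := colour x.1 x.2.

Local Notation E := (exp_graph G (complete_graph m.+4)).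

Lemma clique_adj u j k : j != k -> adj E (u, j) (u, k).
Proof.
by move=> jk; apply/orP; right; rewrite /= /complete_adj jk; apply/forallP => i /=.
Qed.

(** A path of [G] lifts to coordinate [j] and stays in one class by [colour_upd]. *)
Lemma line_connect u j v :
  connect (mono E exp_colour) (u, j) (upd u j v, j).
Proof.
have u_upd : u = upd u j (u j) by apply/ffunP => i; rewrite ffunE; case: eqP => // ->.
rewrite {1}u_upd; have /connectP[p] := G_connected (u j) v.
elim: p (u j) => [|y p IHp] x /=; first by move=> _ ->; apply: connect0.
move=> /andP[xy yp] /(IHp _ yp); apply: connect_trans; apply: connect1.
rewrite /mono /exp_colour /= !colour_upd eqxx andbT /exp_adj /= eqxx !ffunE eqxx xy /=.
by apply/orP; left; apply/forallP => i; rewrite !ffunE; case: (i == j) => /=.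
Qed.

Lemma exp_mono_connected (x y : exp_vertex V J) :
  exp_colour x = exp_colour y -> connect (mono E exp_colour) x y.
Proof.
case: x y => u j [u' j'] cxy; pose b := colour u j.
pose Q u1 u2 := [forall j1, forall j2, (colour u1 j1 == b) ==> (colour u2 j2 == b) ==>
  connect (mono E exp_colour) (u1, j1) (u2, j2)].
have QP u1 u2 : reflect (forall j1 j2, colour u1 j1 = b -> colour u2 j2 = b ->
    connect (mono E exp_colour) (u1, j1) (u2, j2)) (Q u1 u2).
  apply: (iffP forallP) => [Q12 j1 j2 /eqP c1 /eqP c2|Q12 j1].
    by have /forallP/(_ j2) := Q12 j1; rewrite c1 c2.
  by apply/forallP => j2; apply/implyP => /eqP c1; apply/implyP => /eqP c2; apply: Q12.
have Q_refl : reflexive Q.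
  move=> u1; apply/QP => j1 j2 c1 c2; have [->|j12] := eqVneq j1 j2; first exact: connect0.
  by apply: connect1; rewrite /mono clique_adj //= /exp_colour /= c1 c2.
have Q_trans : transitive Q.
  move=> u2 u1 u3 /QP Q12 /QP Q23; apply/QP => j1 j3 c1 c3.
  (* Transitivity needs a vertex of colour [b] over the middle tuple; block 0 always has one. *)
  have c2 : colour u2 (pos false (b (+) block true u2)) = b by rewrite colour_pos addbK.
  exact: connect_trans (Q12 _ _ c1 c2) (Q23 _ _ c2 c3).
have Q_step u1 k v : colour u1 k = b -> Q u1 (upd u1 k v).
  move=> ck; apply/QP => j1 j2 c1 c2.
  have /QP Q1 := Q_refl u1; have /QP Q2 := Q_refl (upd u1 k v).
  apply: connect_trans (Q1 _ _ c1 ck) _; apply: connect_trans (line_connect u1 k v) _.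
  by apply: Q2; rewrite ?colour_upd.
by have /QP := move_everywhere Q_refl Q_trans Q_step u u'; apply; last exact/esym.
Qed.

(* Runs along the 4-cycle of the clique that alternates between the colours
   and meets the blocks in the order 0, 0, 1, 1. *)
Definition clique_phi (x : exp_vertex V J) : exp_vertex V J :=
  let b := ~~ exp_colour x in
  let s := ~~ ((x.2 < 2) (+) b) in
  (x.1, pos s (b (+) block (~~ s) x.1)).

Lemma exp_colour_phi x : exp_colour (clique_phi x) = ~~ exp_colour x.
Proof. by rewrite {1}/exp_colour colour_pos addbK. Qed.

Lemma clique_phi_adj x : adj E x (clique_phi x).
Proof.
case: x => u j; apply: clique_adj; apply/eqP => jE.
have := exp_colour_phi (u, j); rewrite /clique_phi /= -jE.
by case: (exp_colour _).
Qed.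

(** Two successive steps see both colours, so membership in block 0 is toggled exactly once. *)
Lemma clique_phi2 x : clique_phi (clique_phi x) != x.
Proof.
apply/eqP => /(congr1 (fun y : exp_vertex V J => y.2 < 2)).
rewrite {1}/clique_phi /= pos_lt2 exp_colour_phi pos_lt2.
by case: (x.2 < 2); case: (exp_colour x).
Qed.

Lemma exp_complete_cist : exists T : 'I_2 -> sgraph (exp_vertex V J),
  completely_independent_spanning_trees E T.
Proof.
apply: (cist_of_colouring clique_phi_adj exp_colour_phi clique_phi2 exp_mono_connected).
exact: ([ffun=> rep false false], ord0).
Qed.
End ExponentialOfComplete.

Lemma hamiltonian_connected (V : finType) (G : sgraph V) : hamiltonian G -> connected G.
Proof. by move=> [c /and3P[_ cyc _] cV] u v; apply: (connect_cycle cyc). Qed.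

Lemma hamiltonian_card (V : finType) (G : sgraph V) : hamiltonian G -> 3 <= #|V|.
Proof.
move=> [c /and3P[c3 _ /card_uniqP cE] _]; apply: leq_trans c3 _.
by rewrite -cE max_card.
Qed.

(** The labels are the two lowest binary digits of the rank in an enumeration of [V]. *)
Lemma two_bit_labelling (V : finType) : 4 <= #|V| ->
  exists (a e : V -> bool) (rep : bool -> bool -> V),
    (forall x y, a (rep x y) = x) /\ (forall x y, e (rep x y) = y).
Proof.
move=> V4; have i4 (x y : bool) : x + y.*2 < #|V|.
  by apply: leq_trans V4; case: x; case: y.
exists (fun v => odd (enum_rank v)), (fun v => odd (enum_rank v)./2).
exists (fun x y => enum_val (Ordinal (i4 x y))).
by split=> x y; rewrite enum_valK /=; case: x; case: y.
Qed.

Theorem theorem13 (V : finType) (G : sgraph V) (n : nat) :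
  ~~ odd #|V| -> hamiltonian G -> 4 <= n ->
  exists T : 'I_2 -> sgraph (exp_vertex V 'I_n),
    completely_independent_spanning_trees (exp_graph G (complete_graph n)) T.
Proof.
move=> evenV hamG; case: n => [|[|[|[|m]]]] // _.
have V4 : 4 <= #|V|.
  (* A Hamiltonian cycle gives three vertices, and parity excludes exactly three. *)
  have := hamiltonian_card hamG; rewrite leq_eqVlt => /predU1P[V3|//].
  by rewrite -V3 in evenV.
have [a [e [rep [a_rep e_rep]]]] := two_bit_labelling V4.
exact: exp_complete_cist a_rep e_rep (hamiltonian_connected hamG).
Qed.
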